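(* Let $G$ be a finite group and let $\mathcal{C}$ be a non-trivial real conjugacy class of $G$. Suppose that at least one of the following two conditions holds. (A) There exist $x,z\in\mathcal{C}$ such that there is a unique $y\in\mathcal{C}$ with $yxy^{-1}=z$. (B) There exist $x,y,a_0,a_1\in\mathcal{C}$ such that: (1) for all $w\in\mathcal{C}$, $wxw^{-1}=y$ if and only if $w\in\{a_0,a_1\}$; and (2) there exists $g\in G$ of odd order such that $ga_0g^{-1}=a_1$. Then the Killing form $K_{\mathcal{C}}$ is non-degenerate.
   Context: A conjugacy class is real if it is stable under inversion; it is non-trivial if it is not $\{1\}$. For a subset $\mathcal{C}\subset G\setminus\{1\}$ of a finite group $G$ stable under conjugation by $G$, let $\mathbb{C}\mathcal{C}$ be the complex vector space with basis $\mathcal{C}$. The Killing form $K_{\mathcal{C}}$ is the bilinear form on $\mathbb{C}\mathcal{C}$ given on basis elements $a,b\in\mathcal{C}$ by $K_{\mathcal{C}}(a,b)=|C_G(ab)\cap\mathcal{C}|$, where $C_G(ab)$ is the centralizer of $ab$ in $G$. It is non-degenerate if the matrix $(K_{\mathcal{C}}(a,b))_{a,b\in\mathcal{C}}$ is invertible. In (B), $a_0=a_1$ is allowed. *)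

(* Defs.v *)
From HB Require Import structures.
From mathcomp Require Import all_boot all_order all_algebra all_fingroup.
From mathcomp Require Import sesquilinear reals complex.

Set Implicit Arguments.
Unset Strict Implicit.
Unset Printing Implicit Defensive.

Import GroupScope GRing.Theory.
Local Open Scope ring_scope.

Definition nontrivial_real_class (gT : finGroupType) (G : {group gT})
    (C : {set gT}) : Prop :=
  [/\ C \in classes G, C != [set 1%g] & forall x, x \in C -> x^-1%g \in C].

Section KillingForm.
Variables (R : realType) (gT : finGroupType) (G : {group gT}) (C : {set gT}).

(* The complex vector space with basis C; [class_basis a] is the basis vector
   attached to a. *)
Definition class_space : Type := {ffun {x : gT | x \in C} -> R[i]}.

HB.instance Definition _ := GRing.Lmodule.on class_space.

Definition class_basis (a : {x : gT | x \in C}) : class_space :=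
  [ffun b => (b == a)%:R].

Definition killing_coef (a b : gT) : nat := #|'C_G[(a * b)%g] :&: C|.

Definition killing_form (u v : class_space) : R[i] :=
  \sum_a \sum_b u a * v b * (killing_coef (val a) (val b))%:R.

Lemma killing_form_is_bilinear : bilinear_for
  (GRing.Scale.Law.clone _ _ ( *%R ) _) (GRing.Scale.Law.clone _ _ ( *%R ) _)
  killing_form.
Proof.
split=> [v k u1 u2 | u k v1 v2] /=; rewrite /killing_form mulr_sumr -big_split;
  apply: eq_bigr => a _; rewrite mulr_sumr -big_split; apply: eq_bigr => b _;
  rewrite /= !ffunE.
  by rewrite !mulrDl -!mulrA.
by rewrite mulrDr mulrDl -!mulrA [u a * (k * _)]mulrCA.
Qed.

HB.instance Definition _ := bilinear_isBilinear.Build R[i]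
  class_space class_space R[i] _ _ killing_form killing_form_is_bilinear.

Lemma killing_form_basis a b :
  killing_form (class_basis a) (class_basis b) =
  (killing_coef (val a) (val b))%:R.
Proof.
rewrite /killing_form (bigD1 a) //= [X in _ + X]big1 => [|c /negPf ca]; last first.
  by rewrite big1 // => d _; rewrite !ffunE ca !mul0r.
rewrite addr0 (bigD1 b) //= big1 => [|d /negPf db]; last first.
  by rewrite !ffunE db mulr0 mul0r.
by rewrite !ffunE !eqxx !mul1r addr0.
Qed.

Definition killing_mx : 'M[R[i]]_#|{: {x : gT | x \in C}}| :=
  \matrix_(i, j) killing_form (class_basis (enum_val i))
                              (class_basis (enum_val j)).

Definition killing_nondegenerate : Prop := killing_mx \in unitmx.

End KillingForm.

(* Main.v *)
Require Import Defs.
From mathcomp Require Import all_boot all_order all_algebra all_fingroup.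
From mathcomp Require Import reals complex.

(** Let [G] act on the span of [C] by conjugation, and let [rho a] be the
permutation matrix of [a]. The number of points of [C] that commute with
[a * b] is the trace of [rho (a * b)], so the Killing form is
[(a, b) |-> tr (rho a * rho b)]. Since [C] is stable under inversion and
[rho a^-1] is the adjoint of [rho a], the Killing matrix is, up to the row
permutation [a |-> a^-1], the Gram matrix of the family [rho a] for the
Hermitian inner product [tr (A^* B)]. As that product is positive definite, the
Killing form is non-degenerate as soon as the [rho a], for [a] in [C], are
linearly independent.

Reading the relation [sum_a w a *: rho a = 0] entry by entry, a vector [w] in
the kernel has all its fibre sums, that is the sums of [w y] over the [y] in [C]
carrying [x] to [z], equal to zero ([kernel_fibre_sum0]). This family of
equations is invariant under conjugation ([fibre_sum_vanishing_conj]), so by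
transitivity it suffices to show that [w] vanishes at one point of [C].
In case (A), or in case (B) with [a0 = a1], a fibre is reduced to one point, at
which [w] must vanish. In case (B) with [a0 != a1], the equation is
[w a1 = - w a0], and its conjugates have the same form: going around the orbit
of [a0] under [g] in [#[g]] steps changes the sign of [w a0] an odd number of
times, whence [w a0 = - w a0]. *)

Set Implicit Arguments.
Unset Strict Implicit.
Unset Printing Implicit Defensive.

Import GroupScope Order.TTheory GRing.Theory Num.Theory.
Local Open Scope ring_scope.

Section FibreSums.
Variables (F : numClosedFieldType) (gT : finGroupType) (G : {group gT}).
Variable C : {set gT}.
Implicit Types (w : gT -> F) (x y z a b g h : gT).

(** The entry at [(z, x)] of the matrix [sum_y w y *: rho y], where [rho y] is the
0-1 matrix of conjugation by [y], with columns indexed by [C] and rows by the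
ambient group, so that it makes sense for any set [C]. *)
Definition fibre_sum w x z : F := \sum_(y in C | (y * x * y^-1)%g == z) w y.

Definition fibre_sum_vanishing w : Prop :=
  forall x z, x \in C -> fibre_sum w x z = 0.

(** [x] commutes with [a^-1 * b] exactly when [a] and [b] send [x] to the same
point: the coefficient is [tr (rho a^* rho b)]. *)
Lemma killing_coefV a b : C \subset G ->
  killing_coef G C a^-1 b =
  #|[set x in C | (a * x * a^-1 == b * x * b^-1)%g]|.
Proof.
move=> sCG; apply: eq_card => x; rewrite !in_setI [RHS]in_set.
case: (boolP (x \in C)) => xC.
  rewrite (subsetP sCG _ xC) andbT; apply/cent1P/eqP => [cx | e].
    apply: (mulgI a^-1%g); apply: (mulIg b).
    by move: cx; rewrite /commute !mulgA mulVg mul1g mulgKV.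
  apply: (mulgI a); apply: (mulIg b^-1%g).
  by rewrite !mulgA mulgV mul1g mulgK.
by rewrite andbF.
Qed.

(** Both sides are the squared Hilbert-Schmidt norm of
[sum_a w a *: rho a]: expanded bilinearly on the left, as the sum of the squared
moduli of its entries on the right. *)
Lemma killing_hermitian_norm w : C \subset G ->
  \sum_(a in C) \sum_(b in C)
     (w a)^* * w b * (killing_coef G C a^-1 b)%:R =
  \sum_(x in C) \sum_z `|fibre_sum w x z| ^+ 2.
Proof.
move=> sCG.
transitivity (\sum_(a in C) \sum_(b in C) \sum_(x in C)
    (if (a * x * a^-1 == b * x * b^-1)%g then (w a)^* * w b else 0)).
  apply: eq_bigr => a _; apply: eq_bigr => b _.
  rewrite killing_coefV // -big_mkcondr sumr_const mulr_natr.
  by congr (_ *+ _); apply: eq_card => x; rewrite !inE.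
under eq_bigr => a _ do rewrite exchange_big.
rewrite exchange_big /=; apply: eq_bigr => x _.
under [RHS]eq_bigr => z _.
  rewrite normCKC rmorph_sum big_distrlr /= big_mkcondr.
  over.
rewrite [RHS]exchange_big /=; apply: eq_bigr => a _.
rewrite -big_mkcondr -[RHS]big_mkcond.
rewrite [RHS](big_pred1 (a * x * a^-1)%g) => [|z] /=.
  by apply: eq_bigl => b; rewrite eq_sym.
exact: eq_sym.
Qed.

(** Inversion-stability of [C] turns the bilinear kernel condition into the
vanishing of a Hermitian norm. *)
Lemma kernel_fibre_sum0 w : C \subset G ->
    (forall a, a \in C -> a^-1%g \in C) ->
    (forall a, a \in C -> \sum_(b in C) w b * (killing_coef G C a b)%:R = 0) ->
  fibre_sum_vanishing w.
Proof.
move=> sCG CV w0 x z xC.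
have nneg y u : 0 <= `|fibre_sum w y u| ^+ 2 by rewrite exprn_ge0.
have /eqP : \sum_(y in C) \sum_u `|fibre_sum w y u| ^+ 2 = 0.
  rewrite -killing_hermitian_norm // big1 // => a aC.
  under eq_bigr do rewrite -mulrA.
  by rewrite -mulr_sumr w0 ?mulr0 // CV.
rewrite psumr_eq0 => [/allP/(_ x (mem_index_enum x))|y _]; last exact: sumr_ge0.
rewrite xC psumr_eq0 // => /allP/(_ z (mem_index_enum z)).
by rewrite /= expf_eq0 normr_eq0 => /eqP.
Qed.

Lemma fibre_sum_vanishing_conj w g :
    (forall x, (x ^ g \in C)%g = (x \in C)) -> fibre_sum_vanishing w ->
  fibre_sum_vanishing (fun y => w (y ^ g)%g).
Proof.
move=> Cg w0 x z xC; rewrite -[RHS](w0 (x ^ g)%g (z ^ g)%g) ?Cg //.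
rewrite /fibre_sum [RHS](reindex_inj (conjg_inj g)); apply: eq_bigl => y.
by rewrite Cg -conjVg -!conjMg (inj_eq (conjg_inj g)).
Qed.

Lemma fibre_sum_unique w x y z : x \in C -> fibre_sum_vanishing w ->
    (forall u, u \in C -> (u * x * u^-1)%g = z <-> u = y) -> y \in C ->
  w y = 0.
Proof.
move=> xC w0 Uy yC; rewrite -(w0 x z xC) /fibre_sum (big_pred1 y) // => u /=.
apply/andP/eqP => [[uC /eqP/(Uy _ uC)] // | ->].
by split=> //; apply/eqP/(Uy _ yC).
Qed.

Lemma fibre_sum_pair w x z a0 a1 : x \in C -> fibre_sum_vanishing w ->
    a0 \in C -> a1 \in C -> a0 != a1 ->
    (forall u, u \in C -> (u * x * u^-1)%g = z <-> u = a0 \/ u = a1) ->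
  w a1 = - w a0.
Proof.
move=> xC w0 a0C a1C a01 U; apply/eqP; rewrite -addr_eq0 addrC.
rewrite -(w0 x z xC) /fibre_sum (bigD1 a0) /=; last first.
  by rewrite a0C; apply/eqP/(U _ a0C); left.
rewrite (big_pred1 a1) // => u /=.
apply/andP/eqP => [[/andP[uC /eqP/(U _ uC)[->|//]]] | ->].
  by rewrite eqxx.
split; last by rewrite eq_sym.
by rewrite a1C; apply/eqP/(U _ a1C); right.
Qed.

(** The orbit of [a] under [t] closes up after an odd number of sign changes. *)
Lemma odd_orbit_sign0 w a t : odd #[t]%g ->
    (forall n, w (a ^ (t ^+ n.+1))%g = - w (a ^ (t ^+ n))%g) ->
  w a = 0.
Proof.
move=> odd_t wS; have wn n : w (a ^ (t ^+ n))%g = (-1) ^+ n * w a.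
  elim: n => [|n IHn]; first by rewrite expg0 conjg1 mul1r.
  by rewrite wS IHn exprS mulN1r mulNr.
have := wn #[t]%g; rewrite expg_order conjg1 -signr_odd odd_t mulN1r.
by move/eqP; rewrite eq_sym eqNr => /eqP.
Qed.

Lemma fibre_sum_odd_pair w x z a0 a1 g :
    (forall h u, h \in G -> (u ^ h \in C)%g = (u \in C)) ->
    x \in C -> fibre_sum_vanishing w -> a0 \in C -> a1 \in C ->
    (forall u, u \in C -> (u * x * u^-1)%g = z <-> u = a0 \/ u = a1) ->
    g \in G -> odd #[g]%g -> (g * a0 * g^-1)%g = a1 ->
  w a0 = 0.
Proof.
move=> CG xC w0 a0C a1C U gG odd_g a1E.
have [a01|a01] := eqVneq a0 a1.
  apply: (@fibre_sum_unique w x a0 z xC w0 _ a0C) => u uC.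
  by rewrite (U u uC) -a01; split=> [[]|] //; left.
apply: (@odd_orbit_sign0 _ _ g^-1%g) => [|n]; first by rewrite orderV.
have gnG : (g^-1 ^+ n)%g \in G by rewrite groupX ?groupV.
rewrite expgS conjgM [(a0 ^ g^-1)%g]conjgE invgK mulgA a1E.
(* the equation [w a1 = - w a0], for the conjugate of [w] by [g^-1 ^+ n] *)
have wn0 := fibre_sum_vanishing_conj (fun u => CG _ u gnG) w0.
exact: (fibre_sum_pair xC wn0 a0C a1C a01 U).
Qed.

End FibreSums.

(** Translates invertibility of the matrix, indexed through the enumeration of
[C], into a statement on functions on the group. *)
Lemma killing_nondegenerateP (R : realType) (gT : finGroupType)
    (G : {group gT}) (C : {set gT}) :
    (forall w : gT -> R[i],
       (forall a, a \in C ->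
          \sum_(b in C) w b * (killing_coef G C a b)%:R = 0) ->
     forall a, a \in C -> w a = 0) ->
  killing_nondegenerate R G C.
Proof.
move=> ker0; rewrite /killing_nondegenerate -unitmx_tr -row_free_unit.
apply: inj_row_free => v v0.
pose w (y : gT) : R[i] :=
  if insub y is Some u then v 0 (enum_rank u) else 0.
have wE u : w (val u) = v 0 (enum_rank u) by rewrite /w valK.
have w0 := ker0 w; apply/rowP => i; rewrite -(enum_valK i) -wE mxE.
apply: w0 (valP _) => a aC.
transitivity ((v *m (killing_mx R G C)^T) 0 (enum_rank (exist _ a aC))).
  2: by rewrite v0 mxE.
rewrite mxE big_sub (reindex _ (onW_bij _ (enum_val_bij _))) /=.
apply: eq_bigr => j _.
by rewrite wE enum_valK !mxE killing_form_basis enum_rankK.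
Qed.

Theorem theorem1p3 (R : realType) (gT : finGroupType) (G : {group gT})
    (C : {set gT}) (hC : nontrivial_real_class G C)
    (hAB :
      (exists x z : gT, [/\ x \in C, z \in C &
         exists! y : gT, y \in C /\ (y * x * y^-1)%g = z])
      \/
      (exists x y a0 a1 : gT,
         [/\ x \in C, y \in C, a0 \in C & a1 \in C] /\
         (forall w : gT, w \in C ->
            ((w * x * w^-1)%g = y <-> w = a0 \/ w = a1)) /\
         (exists g : gT, [/\ g \in G, odd #[g]%g & (g * a0 * g^-1)%g = a1]))) :
  killing_nondegenerate R G C.
Proof.
case: hC => /imsetP[c cG CE] _ CV.
have sCG : C \subset G by rewrite CE class_subG.
have CJ h u : h \in G -> (u ^ h \in C)%g = (u \in C).
  by move=> hG; rewrite memJ_norm // CE (subsetP (class_norm _ _)).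
have Ctrans a b : a \in C -> b \in C -> exists2 h, h \in G & b = (a ^ h)%g.
  by rewrite CE => /class_eqP <- /imsetP.
apply: killing_nondegenerateP => w /(kernel_fibre_sum0 sCG CV) w0.
suff [a aC a0] : exists2 a, a \in C &
    forall v : gT -> R[i], fibre_sum_vanishing C v -> v a = 0.
  move=> b bC; have [h hG ->] := Ctrans _ _ aC bC.
  exact: a0 (fibre_sum_vanishing_conj (fun u => CJ _ u hG) w0).
case: hAB => [[x [z [xC _ [y [[yC yx] Uy]]]]]|].
  exists y => // v v0.
  apply: (@fibre_sum_unique _ _ _ v x y z xC v0 _ yC) => u uC.
  by split=> [ux | -> //]; symmetry; apply: Uy.
case=> x [z [a0 [a1 [[xC _ a0C a1C] [U [g [gG odd_g a1E]]]]]]].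
exists a0 => // v v0.
exact: (fibre_sum_odd_pair CJ xC v0 a0C a1C U gG odd_g a1E).
Qed.
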